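(* Let $m,n\ge0$ be integers with $m+n\ge1$, let $l,k$ be relatively prime positive integers with $l<k$, and let $q=e^{i\pi l/k}$. Let $F_{l/k}(n|m)=F(n|m)/I_{l/k}(n|m)$ be the quotient of the Fock space $F(n|m)$ of $Cl_q(n|m)$ by the invariant subspace $$I_{l/k}(n|m)=\mathrm{span}\{\,|r_1,\ldots,r_{m+n}\rangle : r_j\ge k\ \text{for at least one } j\in\{1,\ldots,m\}\,\}.$$ Then $F_{l/k}(n|m)$ is a finite-dimensional irreducible $Cl_q(n|m)$-module.
   Context: Notation: $\langle i\rangle=1$ for $i\le m$ and $\langle i\rangle=0$ for $i>m$; $[x]=\frac{q^x-q^{-x}}{q-q^{-1}}$; $q=e^h$ with $h=i\pi l/k$, $q^{\pm1/2}=e^{\pm h/2}$; $c_q=\frac{2}{q^{1/2}+q^{-1/2}}$. The deformed Clifford superalgebra $Cl_q(n|m)$ is the associative unital superalgebra with generators $c_i^\pm$, $N_i$ ($i=1,\ldots,m+n$), of degrees $\deg(c_i^\pm)=\langle i\rangle$, $\deg(N_i)=0$ in $\mathbb{Z}_2$, and relations - $[N_i,N_j]=0$, $[N_i,c_j^\pm]=\pm\delta_{ij}c_j^\pm$; - $c_i^-c_i^+ +(-1)^{\langle i\rangle}q^{\pm1}c_i^+c_i^-=c_q\,q^{\pm(-1)^{\langle i\rangle}N_i}$ (both signs), equivalently $c_i^+c_i^-=c_q[N_i]$ and $c_i^-c_i^+=c_q[1-(-1)^{\langle i\rangle}N_i]$; - $c_i^\xi c_j^\eta=-(-1)^{\langle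 j\rangle}q^{\xi\eta}c_j^\eta c_i^\xi$ for all $i<j$ and $\xi,\eta=\pm$ (identified with $\pm1$); - $(c_i^\pm)^2=0$ for $i=m+1,\ldots,m+n$. For complex $q=e^h$, a $Cl_q(n|m)$-module is a complex vector space with operators $c_i^\pm$ and diagonalizable $N_i$ satisfying these relations, with $q^{\pm N_i}=e^{\pm hN_i}$; submodules are the subspaces invariant under all $c_i^\pm$, $N_i$. The Fock space $F(n|m)$ is the $Cl_q(n|m)$-module generated by a vacuum vector $|0\rangle$ with $c_i^-|0\rangle=0$ and $N_i|0\rangle=0$ for all $i$, in which the vectors $|r_1,\ldots,r_{m+n}\rangle=(c_1^+)^{r_1}\cdots(c_{m+n}^+)^{r_{m+n}}|0\rangle$ ($r_i\in\mathbb{Z}_{\ge 0}$ for $i\le m$, $r_i\in\{0,1\}$ for $i>m$) form a basis. The classes of the vectors with $0\le r_1,\ldots,r_m\le k-1$ and $r_{m+1},\ldots,r_{m+n}\in\{0,1\}$ form a basis of $F_{l/k}(n|m)$. *)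

(* Defs.v *)
From HB Require Import structures.
From mathcomp Require Import all_boot all_order all_algebra.
From mathcomp Require Import all_classical all_reals all_analysis.
From mathcomp Require Import complex.

Set Implicit Arguments.
Unset Strict Implicit.
Unset Printing Implicit Defensive.

Import Order.TTheory GRing.Theory Num.Theory.

Local Open Scope classical_set_scope.
Local Open Scope ring_scope.
Local Open Scope complex_scope.
Local Open Scope quotient_scope.

Section LinearAlgebra.
Variables (K : nzRingType) (V : lmodType K).

(* Finite linear combinations of elements of A, with A arbitrary (V need not
   be finite-dimensional). *)
Definition lin_span (A : set V) : {pred V} := fun v =>
  `[< exists s : seq (K * V), (forall p, p \in s -> A p.2) /\
        v = \sum_(p <- s) p.1 *: p.2 >].

Lemma lin_span_submod (A : set V) : submod_closed (lin_span A).
Proof.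
split; first by apply/asboolP; exists [::]; rewrite big_nil.
move=> a u v /asboolP[s [sA ->]] /asboolP[t [tA ->]]; apply/asboolP.
exists ([seq (a * p.1, p.2) | p <- s] ++ t); split.
  by move=> p; rewrite mem_cat => /orP[/mapP[p' /sA Ap' ->]|/tA].
rewrite big_cat big_map scaler_sumr; congr (_ + _).
by apply: eq_bigr => p _; rewrite scalerA.
Qed.

Lemma lin_span_zmod (A : set V) : zmod_closed (lin_span A).
Proof. exact/GRing.submod_closedB/lin_span_submod. Qed.

HB.instance Definition _ (A : set V) :=
  GRing.isZmodClosed.Build V (lin_span A) (lin_span_zmod A).

Definition is_basis (T : choiceType) (b : T -> V) :=
  (forall (s : seq T) (a : T -> K), uniq s ->
     \sum_(t <- s) a t *: b t = 0 -> forall t, t \in s -> a t = 0) /\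
  lin_span (range b) =i predT.

Definition finite_dimensional := exists (d : nat) (b : 'I_d -> V), is_basis b.

Definition diagonalizable_op (f : V -> V) :=
  exists (T : choiceType) (b : T -> V),
    is_basis b /\ forall t, exists lambda : K, f (b t) = lambda *: b t.

End LinearAlgebra.

(* The library makes Quotient.quot only a zmodType. *)
Section QuotSpan.
Variables (K : nzRingType) (V : lmodType K) (A : set V).

Definition quot_span := Quotient.quot (lin_span A).
HB.instance Definition _ := GRing.Zmodule.on quot_span.
HB.instance Definition _ : EqQuotient V (Quotient.equiv (lin_span A)) quot_span
  := EqQuotient.on quot_span.
HB.instance Definition _ :=
  ZmodQuotient.on quot_span.
Local Notation Q := quot_span.

Definition scaleq (a : K) : Q -> Q := lift_op1 Q ( *:%R a).

Lemma pi_scaleq (a : K) (x : V) : scaleq a (\pi_Q x) = \pi_Q (a *: x).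
Proof.
rewrite /scaleq; unlock; apply/eqP; rewrite -Quotient.idealrBE -scalerBr.
have [_ +] := GRing.submod_closed_semi (lin_span_submod A).
by apply; rewrite Quotient.idealrBE reprK.
Qed.

Let scaleqA a b x : scaleq a (scaleq b x) = scaleq (a * b) x.
Proof. by rewrite -[x]reprK !pi_scaleq scalerA. Qed.

Let scale1q : left_id 1 scaleq.
Proof. by move=> x; rewrite -[x]reprK pi_scaleq scale1r. Qed.

Let scaleqDr : right_distributive scaleq +%R.
Proof.
move=> a x y; rewrite -[x]reprK -[y]reprK -(raddfD \pi_Q) !pi_scaleq.
by rewrite -(raddfD \pi_Q) scalerDr.
Qed.

Let scaleqDl x : {morph scaleq^~ x : a b / a + b}.
Proof.
by move=> a b; rewrite -[x]reprK !pi_scaleq -(raddfD \pi_Q) scalerDl.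
Qed.

HB.instance Definition _ :=
  GRing.Zmodule_isLmodule.Build K Q scaleqA scale1q scaleqDr scaleqDl.

(* The operator induced by f on the quotient; it is computed on representatives,
   hence meaningful when lin_span A is invariant under f. *)
Definition quot_op (f : V -> V) : Q -> Q := lift_op1 Q f.

End QuotSpan.
Arguments quot_op {K V} A f _.

Section Exponential.
Variable R : realType.
Local Notation C := R[i].

Definition cexp (z : C) : C :=
  let: x +i* y := z in (expR x * cos y) +i* (expR x * sin y).

(* E = e^{zA}, for A diagonalizable: E is multiplication by e^{z lambda} on
   the lambda-eigenspace of A.  As the eigenvectors of A span V, this
   determines E. *)
Definition is_exp_op (V : lmodType C) (z : C) (A E : V -> V) :=
  linear E /\
  forall (lambda : C) (v : V),
    A v = lambda *: v -> E v = cexp (z * lambda) *: v.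

End Exponential.

(* Signs are booleans, true being + and false being -; thus c true i is
   c_i^+ and c false i is c_i^-.  The generators are indexed by 'I_(m + n),
   counted from 0, so that <i> is the boolean (i < m). *)
Definition sgnz (s : bool) : int := if s then 1 else -1.

Section Clifford.
Variables (R : realType) (m n : nat).
Local Notation C := R[i].

Section Modules.
Variables (h : C) (V : lmodType C).
Variables (c : bool -> 'I_(m + n) -> V -> V) (N : 'I_(m + n) -> V -> V).

Definition clq_q : C := cexp h.
Definition clq_cq : C := 2 / (cexp (h / 2) + cexp (- (h / 2))).

Record clq_module : Prop := ClqModule {
  clq_c_linear : forall s i, linear (c s i);
  clq_N_linear : forall i, linear (N i);
  clq_N_diag : forall i, diagonalizable_op (N i);
  clq_NN : forall i j v, N i (N j v) - N j (N i v) = 0;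
  clq_Nc : forall i j s v,
    N i (c s j v) - c s j (N i v) =
      ((sgnz s)%:~R * (i == j)%:R) *: c s j v;
  clq_cc : forall (i : 'I_(m + n)) (s : bool), exists E : V -> V,
    is_exp_op ((sgnz s)%:~R * (-1) ^+ (i < m)%N * h) (N i) E /\
    forall v,
      c false i (c true i v)
        + ((-1) ^+ (i < m)%N * clq_q ^ (sgnz s)) *: c true i (c false i v)
      = clq_cq *: E v;
  clq_cross : forall (i j : 'I_(m + n)) (xi eta : bool) v, (i < j)%N ->
    c xi i (c eta j v) =
      (- (-1) ^+ (j < m)%N * clq_q ^ (sgnz xi * sgnz eta))
        *: c eta j (c xi i v);
  clq_nil : forall (i : 'I_(m + n)) s v, (m <= i)%N -> c s i (c s i v) = 0
}.

Definition submodule (W : {pred V}) :=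
  [/\ submod_closed W,
      forall s i v, v \in W -> c s i v \in W &
      forall i v, v \in W -> N i v \in W].

Definition irreducible_module :=
  (exists v : V, v != 0) /\
  forall W : {pred V}, submodule W -> W =i pred1 0 \/ W =i predT.

Definition occupation (r : {ffun 'I_(m + n) -> nat}) : bool :=
  [forall i : 'I_(m + n), (m <= i)%N ==> (r i <= 1)%N].

Definition fock_vec (vac : V) (r : {ffun 'I_(m + n) -> nat}) : V :=
  foldr (fun i v => iter (r i) (c true i) v) vac (enum 'I_(m + n)).

Record fock_space (vac : V) : Prop := FockSpace {
  fock_module : clq_module;
  fock_ann : forall i, c false i vac = 0;
  fock_num : forall i, N i vac = 0;
  fock_gen : forall W : {pred V}, submodule W -> vac \in W -> W =i predT;
  fock_basis :
    is_basis (fun r : {r | occupation r} => fock_vec vac (val r))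
}.

Definition fock_high (vac : V) (k : nat) : set V :=
  [set v | exists r : {ffun 'I_(m + n) -> nat},
    [/\ occupation r, exists j : 'I_(m + n), (j < m)%N /\ (k <= r j)%N &
        v = fock_vec vac r]].

End Modules.
End Clifford.

Definition h_lk (R : realType) (l k : nat) : R[i] :=
  0 +i* (pi * l%:R / k%:R).

(* Main.v *)
Require Import Defs.
From HB Require Import structures.
From mathcomp Require Import all_boot all_order all_algebra.
From mathcomp Require Import all_classical all_reals all_analysis.
From mathcomp Require Import complex.
From mathcomp Require Import ring.

(* In F every c_i^- maps |r + e_i> to a nonzero multiple of [r_i + 1] |r>
   (of |r> itself for i > m), and q = e^{i pi l/k} with gcd(l, k) = 1 gives
   [k] = 0 while [p] <> 0 for 0 < p < k.  The first fact makes I invariant.  By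
   the second, an occupied mode of a vector outside I can be lowered without
   leaving the complement of I; descending on the degree, the preimage in F of a
   nonzero submodule of F/I contains the vacuum, hence is all of F. *)

Set Implicit Arguments.
Unset Strict Implicit.

Import Order.TTheory GRing.Theory Num.Theory.
Local Open Scope ring_scope.
Local Open Scope quotient_scope.

(** * Linear spans and linear maps on them *)

Section LinearSpan.
Variables (K : nzRingType) (V : lmodType K).
Implicit Types (A : set V) (W : {pred V}).

Lemma mem_lin_span A v : A v -> v \in lin_span A.
Proof.
move=> Av; apply/asboolP; exists [:: (1, v)]; split.
  by move=> p; rewrite inE => /eqP ->.
by rewrite big_seq1 scale1r.
Qed.

Lemma lin_span_sub A W : submod_closed W -> (forall v, A v -> v \in W) ->
  forall v, v \in lin_span A -> v \in W.
Proof.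
move=> [W0 WD] AW v /asboolP[s [sA ->]].
elim: s sA => [|p s IHs] sA; first by rewrite big_nil.
rewrite big_cons; apply: WD; first by apply/AW/sA; rewrite inE eqxx.
by apply: IHs => p' p's; apply: sA; rewrite inE p's orbT.
Qed.

Lemma linear0f (U : lmodType K) (f : V -> U) : linear f -> f 0 = 0.
Proof. by move=> fL; have := fL (-1) 0 0; rewrite !scaleN1r !addNr. Qed.

Lemma linearDf (U : lmodType K) (f : V -> U) : linear f ->
  {morph f : x y / x + y}.
Proof. by move=> fL x y; have := fL 1 x y; rewrite !scale1r. Qed.

Lemma linearZf (U : lmodType K) (f : V -> U) : linear f ->
  forall a, {morph f : x / a *: x}.
Proof. by move=> fL a x; have := fL a x 0; rewrite (linear0f fL) !addr0. Qed.

Lemma linear_sumf (U : lmodType K) (f : V -> U) (I : Type) (s : seq I)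
    (P : pred I) (F : I -> V) : linear f ->
  f (\sum_(i <- s | P i) F i) = \sum_(i <- s | P i) f (F i).
Proof.
by move=> fL; apply: (big_morph f (linearDf fL) (linear0f fL)).
Qed.

Lemma preim_submod (U : lmodType K) (f : V -> U) (W : {pred U}) :
  linear f -> submod_closed W -> submod_closed (fun v => f v \in W).
Proof.
move=> fL [W0 WD]; split; first by rewrite unfold_in (linear0f fL).
by move=> a u v; rewrite !unfold_in fL; apply: WD.
Qed.

Lemma linear_span_eq (U : lmodType K) A (f g : V -> U) :
  linear f -> linear g -> (forall v, A v -> f v = g v) ->
  forall v, v \in lin_span A -> f v = g v.
Proof.
move=> fL gL fgA v; move/(lin_span_sub (W := fun v => f v == g v)) => fgv.
apply/eqP/fgv => [|u Au]; last exact/eqP/fgA.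
split=> [|a x y]; rewrite !unfold_in ?(linear0f fL) ?(linear0f gL) //.
by move=> /eqP fgx /eqP fgy; rewrite fL gL fgx fgy.
Qed.

Lemma lin_span_stable A (f : V -> V) : linear f ->
  (forall v, A v -> f v \in lin_span A) ->
  forall v, v \in lin_span A -> f v \in lin_span A.
Proof.
move=> fL; apply: lin_span_sub.
exact: preim_submod fL (lin_span_submod A).
Qed.

End LinearSpan.

(** * Coordinates in a basis that may be infinite *)

Section Coordinates.
Variables (K : nzRingType) (V : lmodType K) (T : choiceType) (b : T -> V).
Hypothesis b_basis : is_basis b.

(** Since [a] must vanish off [s], it is a coordinate function on all of [T], and [v] determines it
    whatever the finite set [s]. *)
Let decomposes (v : V) (a : T -> K) := exists s : seq T,
  [/\ uniq s, forall t, t \notin s -> a t = 0 & v = \sum_(t <- s) a t *: b t].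

Let decomposes_widen v a (s s' : seq T) : uniq s -> uniq s' ->
  (forall t, t \notin s -> a t = 0) -> {subset s <= s'} ->
  v = \sum_(t <- s) a t *: b t -> v = \sum_(t <- s') a t *: b t.
Proof.
move=> us us' a0 ss' ->; rewrite [RHS](bigID (mem s)) /=.
rewrite [X in _ + X]big1 ?addr0 => [|t /a0 ->]; last by rewrite scale0r.
rewrite -[RHS]big_filter; apply: perm_big; apply: uniq_perm => //.
  exact: filter_uniq.
by move=> t; rewrite mem_filter; apply/idP/andP => [ts|[]//]; split; last exact: ss'.
Qed.

Let decomposes_linear x u v a a' : decomposes u a -> decomposes v a' ->
  decomposes (x *: u + v) (fun t => x * a t + a' t).
Proof.
move=> [s [us a0 Du]] [s' [us' a'0 Dv]]; exists (undup (s ++ s')).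
have ss : {subset s <= undup (s ++ s')}.
  by move=> t ts; rewrite mem_undup mem_cat ts.
have s's : {subset s' <= undup (s ++ s')}.
  by move=> t ts'; rewrite mem_undup mem_cat ts' orbT.
split; first exact: undup_uniq.
  move=> t; rewrite mem_undup mem_cat negb_or => /andP[/a0 -> /a'0 ->].
  by rewrite mulr0 addr0.
rewrite (decomposes_widen us (undup_uniq _) a0 ss Du).
rewrite (decomposes_widen us' (undup_uniq _) a'0 s's Dv).
rewrite scaler_sumr -big_split; apply: eq_bigr => t _.
by rewrite scalerDl scalerA.
Qed.

Let decomposes_uniq v a a' : decomposes v a -> decomposes v a' -> a = a'.
Proof.
(* The difference of the two coordinate functions decomposes the zero vector, so independence makes
   it vanish. *)
move=> Da Da'; have := decomposes_linear (-1) Da Da'.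
rewrite scaleN1r addNr => -[s [us a0 sum0]]; apply/funext => t.
have : -1 * a t + a' t = 0.
  have [ts|/a0 //] := boolP (t \in s).
  by apply: (b_basis.1 s (fun t => -1 * a t + a' t) us _ t ts).
by move/eqP; rewrite mulN1r addrC subr_eq0 => /eqP.
Qed.

Let decomposes_basis t : decomposes (b t) (fun t' => (t' == t)%:R).
Proof.
exists [:: t]; split=> //; last by rewrite big_seq1 eqxx scale1r.
by move=> t'; rewrite inE => /negbTE ->.
Qed.

Let decomposes_ex v : exists a, decomposes v a.
Proof.
have : v \in lin_span (range b) by rewrite b_basis.2.
move=> /asboolP[s [sb ->]]; elim: s sb => [|p s IHs] sb.
  by exists (fun=> 0), [::]; split; rewrite ?big_nil.
have /IHs[a Da] : forall p', p' \in s -> range b p'.2.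
  by move=> p' p's; apply: sb; rewrite inE p's orbT.
have [t _ Dp] := sb p (mem_head _ _).
exists (fun t' => p.1 * (t' == t)%:R + a t'); rewrite big_cons -Dp.
exact: decomposes_linear (decomposes_basis t) Da.
Qed.

(** Coordinates exist by spanning and are unique by independence; choice turns them into functions
    of [v], and uniqueness makes these linear. *)
Lemma basis_coord : exists co : T -> V -> K,
  [/\ forall t, linear (co t : V -> K^o),
      forall t t', co t (b t') = (t == t')%:R &
      forall v, exists s : seq T,
        [/\ uniq s, forall t, t \notin s -> co t v = 0 &
            v = \sum_(t <- s) co t v *: b t]].
Proof.
have [co Dco] := choice decomposes_ex.
exists (fun t v => co v t); split=> // [t x u v|t t'].
  have := decomposes_uniq (decomposes_linear x (Dco u) (Dco v)) (Dco _).
  by move/(congr1 (fun g => g t)) => <-.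
by have /(congr1 (fun g => g t)) := decomposes_uniq (Dco _) (decomposes_basis t').
Qed.

End Coordinates.

(** * Operators induced on a quotient space *)

Section QuotientOperators.
Variables (K : nzRingType) (V : lmodType K) (A : set V).
Local Notation Q := (quot_span A).

Lemma quot_spanP (x : Q) : exists v, x = \pi_Q v.
Proof. by exists (repr x); rewrite reprK. Qed.

Lemma pi_linear : linear (fun v => \pi_Q v).
Proof. move=> a u v; rewrite (raddfD \pi_Q); congr (_ + _).
exact/esym/(pi_scaleq A). Qed.

Lemma pi_eq u v : (\pi_Q u = \pi_Q v) <-> u - v \in lin_span A.
Proof. by rewrite Quotient.idealrBE; split=> /eqP. Qed.

Lemma pi_eq0 v : (\pi_Q v = 0) <-> v \in lin_span A.
Proof. by rewrite -(linear0f pi_linear) pi_eq subr0. Qed.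

Variable f : V -> V.
Hypotheses (fL : linear f)
  (fA : forall v, v \in lin_span A -> f v \in lin_span A).

Lemma pi_quot_op v : quot_op A f (\pi_Q v) = \pi_Q (f v).
Proof.
rewrite /quot_op; unlock; apply/pi_eq.
have -> u w : f u - f w = f (u - w).
  by rewrite [u - w]addrC -[- w]scaleN1r fL scaleN1r addrC.
by apply/fA/pi_eq; rewrite reprK.
Qed.

Lemma quot_op_linear : linear (quot_op A f).
Proof.
move=> a x y; have [u ->] := quot_spanP x; have [v ->] := quot_spanP y.
by rewrite -pi_linear !pi_quot_op fL pi_linear.
Qed.

End QuotientOperators.

(** * The exponential, the powers of [q] and the lowering coefficients *)

Section RootOfUnity.
Variable R : realType.
Local Notation C := R[i].

Lemma cexp0 : cexp 0 = 1 :> C.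
Proof. by rewrite /cexp /= expR0 cos0 sin0 mulr1 mulr0. Qed.

Lemma cexpD (x y : C) : cexp (x + y) = cexp x * cexp y.
Proof.
case: x y => [a b] [a' b']; rewrite /cexp /= expRD cosD sinD.
by apply/eqP; rewrite eq_complex /=; apply/andP; split; apply/eqP; ring.
Qed.

Lemma cexp_neq0 (x : C) : cexp x != 0.
Proof.
apply/eqP => x0; have := cexpD x (- x).
by rewrite x0 mul0r subrr cexp0 => /eqP; rewrite oner_eq0.
Qed.

Lemma cexpN (x : C) : cexp (- x) = (cexp x)^-1.
Proof.
by apply: (mulfI (cexp_neq0 x)); rewrite -cexpD subrr cexp0 mulfV ?cexp_neq0.
Qed.

Lemma cexp_natr (x : C) p : cexp (x * p%:R) = cexp x ^+ p.
Proof.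
elim: p => [|p IHp]; first by rewrite mulr0 cexp0.
by rewrite -natr1 mulrDr mulr1 cexpD IHp exprSr.
Qed.

Variables (l k : nat).
Hypotheses (l_gt0 : (0 < l)%N) (l_lt_k : (l < k)%N) (co_lk : coprime l k).
Local Notation h := (h_lk R l k).
Local Notation q := (clq_q h).

(** A primitive [2k]-th root of unity, of which [q] is the [l]-th power. *)
Let zeta : C := cexp (Complex 0 (pi / k%:R)).

Let zeta_expn p :
  zeta ^+ p = Complex (cos (pi / k%:R * p%:R)) (sin (pi / k%:R * p%:R)).
Proof.
rewrite -cexp_natr; have -> : (p%:R : C) = Complex p%:R 0.
  by rewrite -[RHS]/((p%:R)%:C)%C rmorph_nat.
have -> : Complex 0 (pi / k%:R) * Complex p%:R 0
    = Complex 0 (pi / k%:R * p%:R) :> C.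
  by apply/eqP; rewrite eq_complex /=; apply/andP; split; apply/eqP; ring.
by rewrite /cexp expR0 !mul1r.
Qed.

Let q_zeta : q = zeta ^+ l.
Proof.
by rewrite zeta_expn /clq_q /h_lk /cexp expR0 !mul1r mulrAC.
Qed.

Let k_gt0 : (0 < k)%N. Proof. exact: leq_ltn_trans l_lt_k. Qed.

Let zeta_k : zeta ^+ k = -1.
Proof.
rewrite zeta_expn divfK ?cospi ?sinpi ?pnatr_eq0 -?lt0n //.
by apply/eqP; rewrite eq_complex /= oppr0 !eqxx.
Qed.

Lemma q_expn_k : q ^+ k ^+ 2 = 1.
Proof.
by rewrite q_zeta [_ ^+ l ^+ k]exprAC zeta_k exprAC sqrrN !expr1n.
Qed.

(** With [b] the remainder of [l * p] modulo [k], [zeta ^+ k = -1] gives [q^(2p) = zeta^(2b)].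
    Coprimality forces [0 < b < k], so [zeta ^+ b] has imaginary part [sin (pi b / k) > 0] and is
    neither [1] nor [-1]. *)
Lemma q_expn_neq1 p : (0 < p < k)%N -> q ^+ p ^+ 2 != 1.
Proof.
move=> /andP[p_gt0 p_lt_k]; rewrite q_zeta -[_ ^+ l ^+ p]exprM (divn_eq (l * p) k).
set b := (_ %% _)%N.
have b_gt0 : (0 < b)%N.
  rewrite lt0n -/(k %| l * p)%N Gauss_dvdr 1?coprime_sym //.
  by apply: contraTN p_lt_k => /dvdn_leq; rewrite -leqNgt; apply.
have b_lt_k : (b < k)%N by rewrite ltn_mod.
rewrite exprD exprMn mulnC exprM zeta_k exprAC sqrrN !expr1n mul1r.
rewrite sqrf_eq1; apply/negP => zb.
have : sin (pi / k%:R * b%:R) = 0 :> R.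
  by move: zb; rewrite zeta_expn !eq_complex /= oppr0 =>
    /orP[] /andP[_ /eqP].
apply/eqP/lt0r_neq0/sin_gt0_pi; apply/andP; split.
  by rewrite !mulr_gt0 ?invr_gt0 ?pi_gt0 ?ltr0n.
rewrite -mulrA gtr_pMr ?pi_gt0 // mulrC ltr_pdivrMr ?ltr0n //.
by rewrite mul1r ltr_nat.
Qed.

(** The point is that the denominator is nonzero: multiplied by [q^(1/2)] it becomes [q + 1], and
    [q = -1] would contradict [q^2 <> 1]. *)
Lemma clq_cq_neq0 : clq_cq h != 0.
Proof.
rewrite mulf_neq0 ?pnatr_eq0 // invr_eq0; apply/eqP => sum0.
have /q_expn_neq1/eqP[] : (0 < 1 < k)%N by rewrite (leq_ltn_trans l_gt0).
rewrite expr1; suff -> : q = -1 by rewrite sqrrN expr1n.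
have := congr1 ( *%R (cexp (h / 2))) sum0.
by rewrite mulr0 mulrDr -!cexpD subrr -splitr cexp0 => /eqP; rewrite addr_eq0 => /eqP.
Qed.

(* The scalar [c_q [p]] in c_i^- (c_i^+)^p |0> = c_q [p] (c_i^+)^(p-1) |0>
   (b tells whether i <= m), by the recursion that the defining relation gives.
   For i > m only p <= 1 matters. *)
Fixpoint lower_coef (z : C) (b : bool) p : C :=
  if p is p'.+1 then
    clq_cq z * cexp ((-1) ^+ b * z * p'%:R)
      - (-1) ^+ b * clq_q z * lower_coef z b p'
  else 0.

(** Identifies the bosonic coefficient as [c_q [p]]. The denominator of [[p]] is cleared because it
    may vanish for a general [z]. *)
Lemma lower_coef_boson z p :
  (clq_q z - (clq_q z)^-1) * lower_coef z true p
    = clq_cq z * (clq_q z ^+ p - clq_q z ^- p).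
Proof.
elim: p => [|p IHp]; first by rewrite /= mulr0 invr1 subrr mulr0.
rewrite /= !expr1 !mulN1r mulNr cexpN cexp_natr -/(clq_q z).
have q0 : clq_q z != 0 := cexp_neq0 _.
rewrite mulrDr mulNr opprK [X in _ + X]mulrCA IHp exprS.
by field; rewrite expf_neq0 // q0.
Qed.

Let q_neq0 : q != 0. Proof. exact: cexp_neq0. Qed.

Let qBV : q - q^-1 != 0.
Proof.
have /q_expn_neq1 : (0 < 1 < k)%N by rewrite (leq_ltn_trans l_gt0).
apply: contraNneq => /eqP; rewrite subr_eq0 expr1 => /eqP q_eq.
by rewrite expr2 {1}q_eq mulVf.
Qed.

(** From [q^(2k) = 1], [q^k] is its own inverse, so the numerator of [[k]] vanishes. *)
Lemma lower_coef_k : lower_coef h true k = 0.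
Proof.
apply: (mulfI qBV); rewrite lower_coef_boson mulr0.
suff -> : q ^- k = q ^+ k by rewrite subrr mulr0.
have qk : q ^+ k != 0 by rewrite expf_neq0.
by apply: (mulfI qk); rewrite mulfV // -expr2 q_expn_k.
Qed.

(** As [c_q <> 0], a zero coefficient would make [q^p] its own inverse, against [q^(2p) <> 1]. *)
Lemma lower_coef_neq0 p : (0 < p < k)%N -> lower_coef h true p != 0.
Proof.
move=> pk; have := q_expn_neq1 pk; apply: contraNneq => lp0.
have := lower_coef_boson h p; rewrite lp0 mulr0 => /esym/eqP.
rewrite mulf_eq0 (negbTE clq_cq_neq0) subr_eq0 => /eqP q_eq.
by rewrite expr2 {1}q_eq mulVf // expf_neq0.
Qed.

Lemma lower_coef1_neq0 b : lower_coef h b 1 != 0.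
Proof. by rewrite /= !mulr0 subr0 cexp0 mulr1 clq_cq_neq0. Qed.

End RootOfUnity.

(** * Action of the generators on the Fock vectors *)

Section FockVectors.
Variables (R : realType) (m n : nat).
Local Notation C := R[i].
Local Notation I := 'I_(m + n).
Variables (h : C) (F : lmodType C) (c : bool -> I -> F -> F) (N : I -> F -> F).
Hypothesis clq : clq_module h c N.
Implicit Types (s : bool) (i j : I) (r : {ffun I -> nat}) (w v : F).

Let c_lin s i : linear (c s i) := clq_c_linear clq s i.

Let iter_c s i p : linear (iter p (c s i)).
Proof. by elim: p => [|p IHp] a u v //=; rewrite IHp c_lin. Qed.

Definition raise_seq r (s : seq I) v : F :=
  foldr (fun i u => iter (r i) (c true i) u) v s.

Let raise_seq_linear r (s : seq I) : linear (raise_seq r s).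
Proof. by elim: s => [|i s IHs] a u v //=; rewrite IHs iter_c. Qed.

(** The defining relation covers [i < j]; the opposite order follows by inverting its scalar. Signs
    and powers of [q] are hidden in [g], since later arguments only ask whether a coefficient
    vanishes. *)
Lemma c_cross s s' i j : i != j ->
  exists2 g : C, g != 0 & forall v, c s i (c s' j v) = g *: c s' j (c s i v).
Proof.
have g0 j' (z : int) : - (-1) ^+ (j' < m)%N * clq_q h ^ z != 0.
  by rewrite mulf_neq0 ?oppr_eq0 ?signr_eq0 // expfz_neq0 // cexp_neq0.
move=> ij; have [lt_ij|lt_ji|/val_inj eq_ij] := ltngtP i j;
  last by rewrite eq_ij eqxx in ij.
  exists (- (-1) ^+ (j < m)%N * clq_q h ^ (sgnz s * sgnz s')); first exact: g0.
  by move=> v; apply: (clq_cross clq).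
exists (- (-1) ^+ (i < m)%N * clq_q h ^ (sgnz s' * sgnz s))^-1.
  by rewrite invr_eq0 g0.
by move=> v; rewrite (clq_cross clq s' s v lt_ji) scalerA mulVf ?g0 // scale1r.
Qed.

Lemma c_raise_seq s i r (t : seq I) : i \notin t ->
  exists2 g : C, g != 0 &
    forall v, c s i (raise_seq r t v) = g *: raise_seq r t (c s i v).
Proof.
elim: t => [_|j t IHt]; first by exists 1; rewrite ?oner_eq0 // => v; rewrite scale1r.
rewrite inE negb_or => /andP[ij /IHt[g g0 gE]] /=.
have [g' g'0 g'E] := c_cross s true ij.
exists (g' ^+ r j * g) => [|v]; first by rewrite mulf_neq0 ?expf_neq0.
have iterE p u : c s i (iter p (c true j) u) = g' ^+ p *: iter p (c true j) (c s i u).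
  elim: p => [|p IHp]; first by rewrite scale1r.
  by rewrite /= g'E IHp (linearZf (c_lin _ _)) scalerA exprS.
by rewrite iterE gE (linearZf (@iter_c _ _ _)) scalerA.
Qed.

Lemma N_iter i j p v (a : C) : N i v = a *: v ->
  N i (iter p (c true j) v) = (a + (p * (i == j))%:R) *: iter p (c true j) v.
Proof.
move=> Nv; elim: p => [|p IHp]; first by rewrite mul0n addr0.
rewrite /= -[LHS](subrK (c true j (N i (iter p (c true j) v)))) (clq_Nc clq).
rewrite IHp (linearZf (c_lin _ _)) -scalerDl; congr (_ *: _).
by rewrite /= mul1r addrC -addrA -natrD -mulSnr.
Qed.

Lemma N_raise_seq i r (t : seq I) w : N i w = 0 ->
  N i (raise_seq r t w) = (\sum_(j <- t) r j * (i == j))%:R *: raise_seq r t w.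
Proof.
move=> Nw; elim: t => [|j t IHt] /=; first by rewrite big_nil scale0r.
by rewrite (N_iter _ _ IHt) big_cons -natrD [X in X%:R *: _ = _]addnC.
Qed.

(** Induction on [p]: the relation between [c_i^-] and [c_i^+], taken with the plus sign, is exactly
    the recursion defining [lower_coef]. *)
Lemma lower_iter i w p : N i w = 0 -> c false i w = 0 ->
  c false i (iter p (c true i) w)
    = lower_coef h (i < m)%N p *: iter p.-1 (c true i) w.
Proof.
move=> Nw cw; elim: p => [|p IHp] /=; first by rewrite cw scale0r.
have [E [[_ EN] ccE]] := clq_cc clq i true.
rewrite (canRL (addrK _) (ccE _)) IHp (linearZf (c_lin _ _)).
(* The vector [(c_i^+)^p w] has [N_i]-eigenvalue [p], so the exponential operator acts on it by a
   scalar. *)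
rewrite (EN p%:R); last by rewrite (N_iter _ _ (a := 0)) ?scale0r // eqxx muln1 add0r.
rewrite expr1z mul1r !scalerA scalerBl -mulrA; congr (_ - _).
(* At [p = 0] the truncated [p.-1] gives the wrong power of [c_i^+], but the coefficient in front is
   zero. *)
by case: p {IHp} => [|p] //=; rewrite !mulr0 !scale0r.
Qed.

Definition incr r i : {ffun I -> nat} := [ffun j => r j + (j == i)]%N.

Lemma incrE r i j : incr r i j = (r j + (j == i))%N.
Proof. by rewrite ffunE. Qed.

Lemma incr_id r i : incr r i i = (r i).+1.
Proof. by rewrite incrE eqxx addn1. Qed.

Lemma incr_inj i : injective (incr^~ i).
Proof.
move=> r r' eq_rr'; apply/ffunP => j.
by have /ffunP/(_ j) := eq_rr'; rewrite !incrE => /addIn.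
Qed.

Lemma incr_decr r i : (0 < r i)%N -> exists r', r = incr r' i.
Proof.
move=> ri; exists [ffun j => r j - (j == i)]%N; apply/ffunP => j.
by rewrite incrE ffunE; case: eqP => [->|_]; rewrite ?subnK // subn0 addn0.
Qed.

Let raise_seq_incr r i (t : seq I) v : i \notin t ->
  raise_seq (incr r i) t v = raise_seq r t v.
Proof.
elim: t => //= j t IHt; rewrite inE negb_or => /andP[ij /IHt ->].
by rewrite incrE eq_sym (negbTE ij) addn0.
Qed.

Variable vac : F.
Hypotheses (c_vac : forall i, c false i vac = 0) (N_vac : forall i, N i vac = 0).
Local Notation fock := (fock_vec c vac).

(* Peels off the factors standing to the left of [c_i^+], which commute with
   [c_i^+] and [c_i^-] up to a nonzero scalar. *)
Let fock_split r i : exists t w, [/\ i \notin t, N i w = 0, c false i w = 0,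
  fock r = raise_seq r t (iter (r i) (c true i) w) &
  fock (incr r i) = raise_seq r t (iter (r i).+1 (c true i) w)].
Proof.
rewrite /fock_vec; case/splitPr: (mem_enum I i) (enum_uniq I) => t1 t2.
rewrite cat_uniq /= => /and4P[_ /norP[it1 _] it2 _].
(* The witness [w] is the vacuum acted on by the factors to the right of mode [i]. *)
exists t1, (raise_seq r t2 vac); split=> //.
- rewrite N_raise_seq // big1_seq ?scale0r // => j /= jt2.
  by case: eqP it2 => [->|]; rewrite ?jt2 // muln0.
- have [g _ ->] := c_raise_seq false r it2.
  by rewrite c_vac (linear0f (@raise_seq_linear _ _)) scaler0.
- by rewrite foldr_cat.
rewrite foldr_cat /= -/(raise_seq _ _ _) -/(raise_seq _ _ _).
by rewrite !raise_seq_incr // incr_id.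
Qed.

Lemma N_fock r i : N i (fock r) = (r i)%:R *: fock r.
Proof.
rewrite [LHS](N_raise_seq r (enum I) (N_vac i)); congr (_%:R *: _).
rewrite big_enum (bigD1 i) //= eqxx muln1 big1 ?addn0 // => j ji.
by rewrite eq_sym (negbTE ji) muln0.
Qed.

Lemma raise_fock r i : exists g : C, c true i (fock r) = g *: fock (incr r i).
Proof.
have [t [w [it _ _ -> ->]]] := fock_split r i.
by have [g _ gE] := c_raise_seq true r it; exists g; rewrite gE.
Qed.

(** Moving [c_i^-] past the factors to its left costs [g], after which [lower_iter] applies. As
    [g <> 0], the image vanishes only through [lower_coef]. *)
Lemma lower_fock r i : exists2 g : C, g != 0 &
  c false i (fock (incr r i))
    = (g * lower_coef h (i < m)%N (r i).+1) *: fock r.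
Proof.
have [t [w [it Nw cw -> ->]]] := fock_split r i.
have [g g0 gE] := c_raise_seq false r it; exists g => //.
by rewrite gE lower_iter // (linearZf (@raise_seq_linear _ _)) scalerA.
Qed.

Lemma lower_fock0 r i : r i = 0%N -> c false i (fock r) = 0.
Proof.
move=> ri; have [t [w [it Nw cw -> _]]] := fock_split r i.
have [g _ ->] := c_raise_seq false r it; rewrite ri /= cw.
by rewrite (linear0f (@raise_seq_linear _ _)) scaler0.
Qed.

Lemma raise_fock_nil r i : (m <= i)%N -> (0 < r i)%N -> c true i (fock r) = 0.
Proof.
move=> mi ri; have [t [w [it _ _ -> _]]] := fock_split r i.
have [g _ ->] := c_raise_seq true r it.
case: (r i) ri => //= p _; rewrite (clq_nil clq) //.
by rewrite (linear0f (@raise_seq_linear _ _)) scaler0.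
Qed.

End FockVectors.

(** * Coordinates in the Fock space *)

Section FockCoordinates.
Variables (R : realType) (m n : nat).
Local Notation C := R[i].
Local Notation I := 'I_(m + n).
Variables (h : C) (F : lmodType C) (c : bool -> I -> F -> F) (N : I -> F -> F).
Variable vac : F.
Hypothesis FockF : fock_space h c N vac.
Implicit Types (i j : I) (r : {ffun I -> nat}) (v : F).
Local Notation fock := (fock_vec c vac).

Lemma fock_linear_eq (U : lmodType C) (f g : F -> U) : linear f -> linear g ->
  (forall r, occupation r -> f (fock r) = g (fock r)) -> f =1 g.
Proof.
move=> fL gL fg v; have vF : v \in lin_span (range
    (fun r : {r : {ffun I -> nat} | occupation r} => fock (val r))).
  by rewrite (fock_basis FockF).2.
by apply: (linear_span_eq fL gL) vF => _ [r _ <-]; apply/fg/valP.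
Qed.

(** The coordinates are extended by zero to inadmissible [r], so that they are indexed by plain
    functions instead of a subtype. *)
Lemma fock_coord : exists co : {ffun I -> nat} -> F -> C,
  [/\ forall r, linear (co r : F -> C^o),
      forall r r', occupation r' -> co r (fock r') = (r == r')%:R &
      forall v, exists s : seq {ffun I -> nat},
        [/\ forall r, r \in s -> occupation r, forall r, r \notin s -> co r v = 0 &
            v = \sum_(r <- s) co r v *: fock r]].
Proof.
have [co [coL coE co_sum]] := basis_coord (fock_basis FockF).
exists (fun r v => if insub r is Some t then co t v else 0).
split=> [r a u v|r r' occ|v].
- by case: insub => [t|]; [exact: coL|rewrite scaler0 addr0].
- case: insubP => [t _ <-|nocc]; first exact: (coE t (exist _ r' occ)).
  by case: eqP => // r_eq; rewrite r_eq occ in nocc.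
have [s [us s0 vE]] := co_sum v; exists (map val s); split.
- by move=> _ /mapP[t _ ->]; apply: valP.
- move=> r rs; case: insubP => // t _ r_eq; apply: s0.
  by apply: contra rs => ts; rewrite -r_eq map_f.
by rewrite {1}vE big_map; apply: eq_bigr => t _; rewrite valK.
Qed.

End FockCoordinates.

(** * The subspace [I] of high occupation and its invariance *)

Section TruncatedFock.
Variables (R : realType) (m n l k : nat).
Hypotheses (l_gt0 : (0 < l)%N) (l_lt_k : (l < k)%N) (co_lk : coprime l k).
Local Notation C := R[i].
Local Notation I := 'I_(m + n).
Variables (F : lmodType C) (c : bool -> I -> F -> F) (N : I -> F -> F).
Variable vac : F.
Local Notation h := (h_lk R l k).
Hypothesis FockF : fock_space h c N vac.
Implicit Types (i j : I) (r : {ffun I -> nat}) (v : F).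
Local Notation fock := (fock_vec c vac).
Local Notation B := (fock_high c vac k).
Local Notation Q := (quot_span B).

Variable co : {ffun I -> nat} -> F -> C.
Hypotheses (coL : forall r, linear (co r : F -> C^o))
  (coE : forall r r', occupation r' -> co r (fock r') = (r == r')%:R)
  (co_sum : forall v, exists s : seq {ffun I -> nat},
    [/\ forall r, r \in s -> occupation r, forall r, r \notin s -> co r v = 0 &
        v = \sum_(r <- s) co r v *: fock r]).

Let coLE r a u v : co r (a *: u + v) = a * co r u + co r v.
Proof. exact: coL. Qed.

Let coZ r a v : co r (a *: v) = a * co r v.
Proof. exact: (linearZf (coL r)). Qed.

Let clq := fock_module FockF.
Let c_lin s i : linear (c s i) := clq_c_linear clq s i.
Let N_lin i : linear (N i) := clq_N_linear clq i.

Definition low r := [forall i : I, (i < m)%N ==> (r i < k)%N].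

Let k_gt1 : (1 < k)%N. Proof. exact: leq_ltn_trans l_gt0 l_lt_k. Qed.

Lemma notlow r : ~~ low r -> exists j : I, (j < m)%N /\ (k <= r j)%N.
Proof.
rewrite negb_forall => /existsP[j]; rewrite negb_imply -leqNgt => /andP[jm kr].
by exists j.
Qed.

(** Turns membership in [I] into a test on coordinates: the admissible Fock vectors that are not
    [low] are precisely the generators of [I]. *)
Lemma high_co v : v \in lin_span B <-> forall r, low r -> co r v = 0.
Proof.
split=> [vB r r_low|v0].
  have zL : linear ((fun=> 0) : F -> C^o).
    by move=> a x y; rewrite scaler0 addr0.
  apply: (linear_span_eq (coL r) zL _ vB) => _ [r' [occ [j [jm kr]] ->]].
  rewrite coE //; case: eqP => // r_eq; move/forallP/(_ j): r_low.
  by rewrite jm r_eq ltnNge kr.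
have [s [occ _ ->]] := co_sum v; have [_ +] := lin_span_submod B => BL.
rewrite big_seq; elim/big_rec: _ => [|r x rs xB]; first by case: (lin_span_submod B).
have [r_low|/notlow r_high] := boolP (low r); first by rewrite v0 // scale0r add0r.
by apply: BL => //; apply: mem_lin_span; exists r; split=> //; apply: occ.
Qed.

Lemma co_occ r v : co r v != 0 -> occupation r.
Proof.
have [s [occ s0 _]] := co_sum v => r0; apply: occ.
by apply: contraNT r0 => /s0 ->.
Qed.

Let high_scale a v : v \in lin_span B -> a *: v \in lin_span B.
Proof.
move=> /high_co v0; apply/high_co => r r_low.
by rewrite coZ v0 // mulr0.
Qed.

Let co_diag (f : F -> F) (a : {ffun I -> nat} -> C) : linear f ->
    (forall r, f (fock r) = a r *: fock r) ->
  forall r v, co r (f v) = a r * co r v.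
Proof.
move=> fL fE r; apply: (fock_linear_eq FockF (U := C^o)).
- by move=> x u v; rewrite fL coLE.
- by move=> x u v; rewrite coLE mulrDr mulrCA.
move=> r' occ; rewrite fE coZ coE //.
by case: eqP => [->|]; rewrite // !mulr0.
Qed.

Let high_diag (f : F -> F) (a : {ffun I -> nat} -> C) : linear f ->
    (forall r, f (fock r) = a r *: fock r) ->
  forall v, v \in lin_span B -> f v \in lin_span B.
Proof.
move=> fL fE v /high_co v0; apply/high_co => r r_low.
by rewrite (co_diag fL fE) v0 // mulr0.
Qed.

Let NE i r : N i (fock r) = (r i)%:R *: fock r.
Proof. exact: (N_fock clq (fock_num FockF)). Qed.

Let high_N i v : v \in lin_span B -> N i v \in lin_span B.
Proof. exact: high_diag (N_lin i) (NE i) v. Qed.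

Let lowerE := lower_fock clq (fock_ann FockF) (fock_num FockF).
Let lower0E := lower_fock0 clq (fock_ann FockF) (fock_num FockF).

Let occ_incr r i : occupation (incr r i) -> occupation r.
Proof.
move=> /forallP occ; apply/forallP => j; apply/implyP => mj.
by have := occ j; rewrite mj incrE; apply: leq_trans; rewrite leq_addr.
Qed.

(** The transpose of [lower_fock]: only [r + e_i] is lowered to [r] by [c_i^-]. Both sides are
    linear in [v], so the basis decides. *)
Lemma co_lower r i : exists2 g : C, g != 0 & forall v,
  co r (c false i v) = g * lower_coef h (i < m)%N (r i).+1 * co (incr r i) v.
Proof.
have [g g0 gE] := lowerE r i; exists g => //.
apply: (fock_linear_eq FockF (U := C^o)).
- by move=> x u v; rewrite c_lin coLE.
- by move=> x u v; rewrite coLE mulrDr mulrCA.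
move=> r' occ; rewrite coE //.
have [r'i0|/incr_decr[r'' r'E]] := posnP (r' i).
  rewrite lower0E // (linear0f (coL r)); case: eqP => [r'E|]; last by rewrite mulr0.
  by rewrite -r'E incr_id in r'i0.
rewrite r'E (inj_eq (@incr_inj _ _ i)); rewrite r'E in occ.
have occ'' := occ_incr occ; case: eqVneq => [r_eq|ne_r].
  by rewrite -r_eq gE coZ coE ?eqxx // r_eq.
have [g' _ ->] := lowerE r'' i.
by rewrite coZ coE // (negbTE ne_r) !mulr0.
Qed.

(** Adding [e_i] destroys [low] only if mode [i] is bosonic with [r i = k - 1], and then the
    coefficient is [c_q [k] = 0]. *)
Let lower_coef_last i r : low r -> ~~ low (incr r i) ->
  lower_coef h (i < m)%N (r i).+1 = 0.
Proof.
move=> r_low /notlow[j [jm]]; rewrite incrE.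
have rj : (r j < k)%N by have := forallP r_low j; rewrite jm.
case: eqP => [ji|_]; last by rewrite addn0 leqNgt rj.
rewrite addn1 -ji jm => k_le.
have -> : (r j).+1 = k by apply/eqP; rewrite eqn_leq rj k_le.
by apply: lower_coef_k.
Qed.

(** Raising never decreases an occupation. Lowering could leave [I] only by taking a mode from [k]
    to [k - 1], where the coefficient vanishes. *)
Let high_c s i v : v \in lin_span B -> c s i v \in lin_span B.
Proof.
apply: lin_span_stable => // _ [r [occ [j [jm kr]] ->]].
have span0 : 0 \in lin_span B by have [] := lin_span_submod B.
case: s; last first.
  have [ri0|/incr_decr[r' rE]] := posnP (r i); first by rewrite lower0E.
  rewrite rE in occ kr *; have [g _ ->] := lowerE r' i.
  have [r'_low|r'_high] := boolP (low r').
    rewrite lower_coef_last ?mulr0 ?scale0r //.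
    by apply/negP => /forallP/(_ j); rewrite jm ltnNge kr.
  apply/high_scale/mem_lin_span; exists r'; split=> //; last exact: notlow.
  exact: occ_incr occ.
(* Raising an occupied fermionic mode gives zero; in every other case [r + e_i] is again
   admissible. *)
have [mi_ri|free] := boolP ((m <= i)%N && (0 < r i)%N).
  have /andP[mi ri] := mi_ri.
  by rewrite (raise_fock_nil clq (fock_ann FockF) (fock_num FockF)).
have [g ->] := raise_fock clq (fock_ann FockF) (fock_num FockF) r i.
apply/high_scale/mem_lin_span; exists (incr r i); split=> //.
  apply/forallP => i'; apply/implyP => mi'; rewrite incrE.
  have := forallP occ i'; rewrite mi' /=; case: eqP => [ii'|_]; last by rewrite addn0.
  by move: free; rewrite -ii' mi' /= -eqn0Ngt => /eqP ->.
by exists j; rewrite jm incrE (leq_trans kr) // leq_addr.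
Qed.

Lemma high_submodule : submodule c N (lin_span B).
Proof. by split; [exact: lin_span_submod|exact: high_c|exact: high_N]. Qed.

Definition degree r := (\sum_i r i)%N.

Lemma degree_incr r i : degree (incr r i) = (degree r).+1.
Proof.
rewrite /degree; under eq_bigr => j _ do rewrite incrE.
rewrite big_split /= -addn1; congr (_ + _)%N.
by rewrite (bigD1 i) //= eqxx big1 ?addn0 // => j /negbTE ->.
Qed.

Let zero_occ : {ffun I -> nat} := [ffun=> 0%N].

Let fock0 : fock zero_occ = vac.
Proof. by rewrite /fock_vec; elim: (enum _) => //= i t ->; rewrite ffunE. Qed.

Let low0 : low zero_occ.
Proof. by apply/forallP => i; rewrite ffunE (ltnW k_gt1) implybT. Qed.

Let occ0 : occupation zero_occ.
Proof. by apply/forallP => i; rewrite ffunE implybT. Qed.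

(** * Descent to the vacuum in a submodule containing [I] *)

Section LowerToVacuum.
Variable W : {pred F}.
Hypotheses (subW : submodule c N W)
  (highW : forall v, v \in lin_span B -> v \in W).

(** Such a [v] is a nonzero multiple of the vacuum modulo [I], and [W] contains [I]. *)
Let vac_of_support v : v \in W -> (exists r, low r /\ co r v != 0) ->
  (forall r, low r -> co r v != 0 -> r = zero_occ) -> vac \in W.
Proof.
have [[W0 WL] _ _] := subW => vW [r0 [r0_low r0v]] supp0.
have v0 : co zero_occ v != 0 by rewrite -(supp0 r0).
have high_v : v - co zero_occ v *: vac \in lin_span B.
  apply/high_co => r r_low; rewrite addrC -scaleNr coLE -[vac]fock0 coE //.
  case: eqVneq => [->|ne_r]; first by rewrite mulr1 addNr.
  rewrite mulr0 add0r; apply/eqP; apply: contraNT ne_r => rv.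
  by rewrite (supp0 r).
(* Written as nested combinations [a *: u + v], the form in which closure of [W] is given. *)
have -> : vac = - (co zero_occ v)^-1 *: ((-1) *: v + (v - co zero_occ v *: vac)) + 0.
  by rewrite scaleN1r addKr addr0 scalerN scaleNr opprK scalerA mulVf // scale1r.
by apply: (WL) => //; apply: (WL) => //; apply: highW.
Qed.

(* An occupied mode of a vector in the support can be lowered without
   annihilating the vector, and the lowered vector has smaller degree. *)
Lemma vac_of_nonhigh v : v \in W -> (exists r, low r /\ co r v != 0) -> vac \in W.
Proof.
(* The finite support of [v] bounds the degrees of its low terms; the induction is on this bound,
   for all vectors of [W] at once. *)
have [D] : exists D, forall r, low r -> co r v != 0 -> (degree r <= D)%N.
  have [s [_ s0 _]] := co_sum v; exists (\max_(r <- s) degree r)%N => r _ rv.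
  by apply: leq_bigmax_seq => //; apply: contraNT rv => /s0 ->.
elim: D v => [|D IHD] v vD vW v_low.
  apply: vac_of_support vW v_low _ => r r_low rv; apply/ffunP => i; rewrite ffunE.
  by have := vD r r_low rv; rewrite leqn0 sum_nat_eq0 => /forallP/(_ i)/eqP.
have [[r [i [r_low rv ri]]]|supp0] :=
  pselect (exists r i, [/\ low r, co r v != 0 & (0 < r i)%N]); last first.
  apply: vac_of_support vW v_low _ => r r_low rv; apply/ffunP => i; rewrite ffunE.
  by apply/eqP; rewrite -leqn0 leqNgt; apply/negP => ri; apply: supp0; exists r, i.
have [_ Wc _] := subW; apply: (IHD (c false i v)); last first.
- have [r' rE] := incr_decr ri; exists r'.
  have r'_low : low r'.
    apply/forallP => j; apply/implyP => jm; have := forallP r_low j.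
    by rewrite jm rE incrE; apply: leq_ltn_trans; rewrite leq_addr.
  split=> //; have [g g0 ->] := co_lower r' i; rewrite -rE !mulf_neq0 //.
  have -> : (r' i).+1 = r i by rewrite rE incr_id.
  (* A bosonic mode has [0 < r i < k], so [[r i]] is nonzero; an occupied fermionic mode has
     [r i = 1], with coefficient [c_q]. *)
  have [im|mi] := ltnP i m.
    by apply: lower_coef_neq0 => //; rewrite ri; have := forallP r_low i; rewrite im.
  suff -> : r i = 1%N by apply: lower_coef1_neq0 l_gt0 l_lt_k co_lk _.
  by apply/eqP; rewrite eqn_leq ri andbT; have := forallP (co_occ rv) i; rewrite mi.
- exact: Wc.
move=> r' r'_low; have [g g0 ->] := co_lower r' i.
rewrite !mulf_eq0 !negb_or => /andP[/andP[_ coef0] r'v].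
(* A low term [r'] of the lowered vector comes from the term [r' + e_i] of [v]. This one is low too,
   since otherwise its coefficient would vanish, so its degree is at most [D.+1]. *)
rewrite -ltnS -(degree_incr r' i); apply: vD => //.
by apply: contraNT coef0 => /lower_coef_last ->.
Qed.

End LowerToVacuum.

(** * The quotient module: basis, relations and irreducibility *)

Local Notation pi v := (\pi_Q v).

Let piE s i v : quot_op B (c s i) (pi v) = pi (c s i v).
Proof. exact: (pi_quot_op (c_lin s i) (@high_c s i)). Qed.

Let piN i v : quot_op B (N i) (pi v) = pi (N i v).
Proof. exact: (pi_quot_op (N_lin i) (@high_N i)). Qed.

Let piZ a v : pi (a *: v) = a *: pi v.
Proof. exact: (linearZf (pi_linear B)). Qed.

Let piD u v : pi (u + v) = pi u + pi v.
Proof. exact: (linearDf (pi_linear B)). Qed.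

Let pi0 : pi 0 = 0.
Proof. exact: (linear0f (pi_linear B)). Qed.

Let piB u v : pi (u - v) = pi u - pi v.
Proof. by rewrite -!(scaleN1r v) piD piZ scaleN1r. Qed.

(** All entries of a low admissible [r] are below [k], the fermionic ones because [1 < k], so these
    [r] embed in a finite type. *)
Lemma low_enum : exists d (f : 'I_d -> {ffun I -> nat}),
  [/\ injective f, forall t, occupation (f t) /\ low (f t) &
      forall r, occupation r -> low r -> exists t, f t = r].
Proof.
pose nat_of (g : {ffun I -> 'I_k}) : {ffun I -> nat} := [ffun i => val (g i)].
pose S := [set g | occupation (nat_of g)].
exists #|S|, (fun t => nat_of (enum_val t)); split.
- move=> t t' /ffunP eq_tt'; apply/enum_val_inj/ffunP => i; apply/val_inj.
  by have := eq_tt' i; rewrite !ffunE.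
- move=> t; split; first by have := enum_valP t; rewrite inE.
  by apply/forallP => i; rewrite ffunE ltn_ord implybT.
move=> r occ r_low; have r_lt i : (r i < k)%N.
  have [im|mi] := ltnP i m; first by have := forallP r_low i; rewrite im.
  by have := forallP occ i; rewrite mi => /leq_ltn_trans; apply.
pose g : {ffun I -> 'I_k} := [ffun i => Ordinal (r_lt i)].
have gr : nat_of g = r by apply/ffunP => i; rewrite !ffunE.
have gS : g \in S by rewrite inE gr.
by exists (enum_rank_in gS g); rewrite enum_rankK_in.
Qed.

(** A relation in the quotient puts a combination of low vectors in [I], where low coordinates
    vanish. For spanning, the remaining Fock vectors map to zero. *)
Lemma quot_basis d (f : 'I_d -> {ffun I -> nat}) : injective f ->
    (forall t, occupation (f t) /\ low (f t)) ->
    (forall r, occupation r -> low r -> exists t, f t = r) ->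
  is_basis (fun t => pi (fock (f t))).
Proof.
move=> f_inj f_low f_surj; split=> [s a us|x].
  under eq_bigr => t _ do rewrite -piZ.
  rewrite -(linear_sumf _ _ _ (pi_linear B)) => /pi_eq0/high_co sum0 t ts.
  have := sum0 (f t) (f_low t).2; rewrite (linear_sumf _ _ _ (coL (f t))).
  rewrite (bigD1_seq t) //= coZ coE ?eqxx ?mulr1 ?(f_low t).1 // big1 ?addr0 //.
  move=> t' /negbTE ne_t; rewrite coZ coE ?(f_low t').1 //.
  by rewrite (inj_eq f_inj) eq_sym ne_t mulr0.
have [v ->] := quot_spanP x; rewrite [RHS]inE.
have [s [occ _ ->]] := co_sum v; rewrite (linear_sumf _ _ _ (pi_linear B)) big_seq.
have [span0 spanL] := lin_span_submod (range (fun t => pi (fock (f t)))).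
elim/big_rec: _ => // r y rs y_span; rewrite piZ; apply: spanL => //.
have [r_low|/notlow r_high] := boolP (low r).
  by have [t <-] := f_surj r (occ r rs) r_low; apply: mem_lin_span; exists t.
suff -> : pi (fock r) = 0 by [].
by apply/pi_eq0/mem_lin_span; exists r; split=> //; apply: occ.
Qed.

(** [E] is diagonal in the Fock basis, hence preserves [I] and descends. An eigenvector of the
    induced [N_i] lifts to a vector that is an eigenvector only modulo [I], so the exponential is
    checked coordinate by coordinate. *)
Let quot_exp i (z : C) E : is_exp_op z (N i) E ->
  is_exp_op z (quot_op B (N i)) (quot_op B E) /\
  forall v, quot_op B E (pi v) = pi (E v).
Proof.
move=> [EL EN]; have EE r : E (fock r) = cexp (z * (r i)%:R) *: fock r.
  exact/EN/NE.
have EB := high_diag EL EE; have piEE := pi_quot_op EL EB.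
split=> //; split; first exact: (quot_op_linear EL EB).
move=> lambda x; have [v ->] := quot_spanP x.
rewrite piN piEE -!piZ => /pi_eq/high_co Nv; apply/pi_eq/high_co => r r_low.
have coB u w : co r (u - w) = co r u - co r w.
  by rewrite addrC -scaleN1r coLE mulN1r addrC.
move: (Nv r r_low); rewrite !coB !coZ (co_diag (N_lin i) (NE i)) (co_diag EL EE).
(* For each low [r], either [r i] equals the eigenvalue or the coordinate is zero; the two sides
   agree in both cases. *)
rewrite -!mulrBl => /eqP; rewrite mulf_eq0 => /orP[|/eqP ->]; last by rewrite mulr0.
by rewrite subr_eq0 => /eqP ->; rewrite subrr mul0r.
Qed.

Lemma quot_clq_module :
  clq_module h (fun s i => quot_op B (c s i)) (fun i => quot_op B (N i)).
Proof.
split.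
- by move=> s i; apply: quot_op_linear (c_lin s i) (@high_c s i).
- by move=> i; apply: quot_op_linear (N_lin i) (@high_N i).
- move=> i; have [d [f [f_inj f_low f_surj]]] := low_enum.
  exists 'I_d, (fun t => pi (fock (f t))); split; first exact: quot_basis.
  by move=> t; exists (f t i)%:R; rewrite piN NE piZ.
- move=> i j x; have [v ->] := quot_spanP x.
  by rewrite !piN -piB (clq_NN clq) pi0.
- move=> i j s x; have [v ->] := quot_spanP x.
  by rewrite !(piN, piE) -piB (clq_Nc clq) piZ.
- move=> i s; have [E [E_exp ccE]] := clq_cc clq i s.
  have [QE_exp QE] := quot_exp E_exp; exists (quot_op B E); split=> // x.
  have [v ->] := quot_spanP x.
  by rewrite !piE QE -!piZ -piD ccE.
- move=> i j xi eta x ij; have [v ->] := quot_spanP x.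
  by rewrite !piE -piZ (clq_cross clq).
move=> i s x mi; have [v ->] := quot_spanP x.
by rewrite !piE (clq_nil clq) // pi0.
Qed.

Lemma quot_finite_dimensional : finite_dimensional Q.
Proof.
have [d [f [f_inj f_low f_surj]]] := low_enum.
by exists d, (fun t => pi (fock (f t))); apply: quot_basis.
Qed.

Lemma quot_irreducible :
  irreducible_module (fun s i => quot_op B (c s i)) (fun i => quot_op B (N i)).
Proof.
split.
  (* The vacuum is outside [I]: its coordinate at the zero occupation, which is low, is [1]. *)
  exists (pi vac); apply/eqP => /pi_eq0/high_co/(_ _ low0)/eqP.
  by rewrite -fock0 coE // eqxx oner_eq0.
move=> W [WL Wc WN].
have [[x [xW x0]]|W0] := pselect (exists x, x \in W /\ x != 0); last first.
  left=> x; rewrite inE; apply/idP/eqP => [xW|->]; last by case: WL.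
  by apply/eqP/negPn/negP => x0; apply: W0; exists x.
right=> y; have [w ->] := quot_spanP y.
(* The preimage of [W] contains [I] and a vector outside [I], hence the vacuum, and the vacuum
   generates [F]. *)
pose W' : {pred F} := fun v => pi v \in W.
have subW' : submodule c N W'.
  split; first exact: preim_submod (pi_linear B) WL.
    by move=> s i v; rewrite !unfold_in -piE; apply: Wc.
  by move=> i v; rewrite !unfold_in -piN; apply: WN.
suff vacW' : vac \in W' by exact: (fock_gen FockF subW' vacW' w).
have [v xE] := quot_spanP x; rewrite xE in xW x0.
apply: (vac_of_nonhigh subW' _ xW).
  move=> u /pi_eq0; rewrite unfold_in => ->; by case: WL.
apply/not_existsP => no_low; move/eqP: x0; apply; apply/pi_eq0/high_co => r r_low.
by apply/eqP/negPn/negP => rv; apply: (no_low r).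
Qed.

End TruncatedFock.

Theorem proposition4 (R : realType) (m n l k : nat)
  (mn_gt0 : (0 < m + n)%N) (l_gt0 : (0 < l)%N) (l_lt_k : (l < k)%N)
  (co_lk : coprime l k)
  (F : lmodType R[i])
  (c : bool -> 'I_(m + n) -> F -> F) (N : 'I_(m + n) -> F -> F) (vac : F)
  (FockF : fock_space (h_lk R l k) c N vac) :
  let B := fock_high c vac k in
  let cQ (s : bool) (i : 'I_(m + n)) := quot_op B (c s i) in
  let NQ (i : 'I_(m + n)) := quot_op B (N i) in
  [/\ submodule c N (lin_span B),
      clq_module (h_lk R l k) cQ NQ,
      finite_dimensional (quot_span B) &
      irreducible_module cQ NQ].
Proof.
have [co [coL coE co_sum]] := fock_coord FockF.
split.
- exact: (high_submodule l_gt0 l_lt_k co_lk FockF coL coE co_sum).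
- exact: (quot_clq_module l_gt0 l_lt_k co_lk FockF coL coE co_sum).
- exact: (quot_finite_dimensional l_gt0 l_lt_k coL coE co_sum).
- exact: (quot_irreducible l_gt0 l_lt_k co_lk FockF coL coE co_sum).
Qed.
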